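(* Let $k$ be a field of characteristic zero, let $s\geq 2$, $t\geq 1$ and $u\geq 0$ be integers, and let $c_1,c_2\in k\setminus\{0\}$. Let $d$ denote the $k$-derivation $\partial_x + x^u(c_1x^t+c_2y^s)\partial_y$ of the polynomial ring $k[x,y]$. Then $d$ is a simple derivation of $k[x,y]$.
   Context: A derivation $d$ of a commutative ring $A$ with unity is a map $d:A\to A$ with $d(a+b)=d(a)+d(b)$ and $d(ab)=a\,d(b)+b\,d(a)$ for all $a,b\in A$; if $A$ is a $k$-algebra, a $k$-derivation is a derivation that is also $k$-linear. An ideal $I$ of $A$ is $d$-differential if $d(I)\subseteq I$. The derivation $d$ is called simple if $\{0\}$ and $A$ are the only $d$-differential ideals of $A$. For $P,Q\in k[x,y]$, $P\partial_x+Q\partial_y$ denotes the unique $k$-derivation of $k[x,y]$ sending $x\mapsto P$ and $y\mapsto Q$. *)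

(* Defs.v *)
From HB Require Import structures.
From mathcomp Require Import all_boot all_order all_algebra.
From mathcomp Require Import mpoly.

Set Implicit Arguments.
Unset Strict Implicit.
Unset Printing Implicit Defensive.

Import GRing.Theory.
Local Open Scope ring_scope.

Definition is_derivation (A : comPzRingType) (d : A -> A) : Prop :=
  (forall a b, d (a + b) = d a + d b) /\
  (forall a b, d (a * b) = a * d b + b * d a).

Definition is_kderivation (k : fieldType) (A : comAlgType k) (d : A -> A)
    : Prop :=
  is_derivation d /\ (forall (c : k) a, d (c *: a) = c *: d a).

(* Ideals are Prop-valued predicates, so that no decidability of membership
   is assumed; closure under opposites follows from [a := -1]. *)
Definition is_ideal (A : comPzRingType) (I : A -> Prop) : Prop :=
  [/\ I 0, (forall a b, I a -> I b -> I (a + b))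
    & (forall a b, I b -> I (a * b))].

Definition is_differential_ideal (A : comPzRingType) (d : A -> A)
    (I : A -> Prop) : Prop :=
  is_ideal I /\ (forall a, I a -> I (d a)).

Definition is_simple_derivation (A : comPzRingType) (d : A -> A) : Prop :=
  is_derivation d /\
  (forall I : A -> Prop, is_differential_ideal d I ->
     (forall a, I a <-> a = 0) \/ (forall a, I a)).

Definition varx (k : fieldType) : {mpoly k[2]} := 'X_ord0.
Definition vary (k : fieldType) : {mpoly k[2]} := 'X_ord_max.

Definition derxy (k : fieldType) (P Q : {mpoly k[2]}) (f : {mpoly k[2]})
    : {mpoly k[2]} :=
  P * mderiv ord0 f + Q * mderiv ord_max f.

Lemma derxy_kderivation (k : fieldType) (P Q : {mpoly k[2]}) :
  is_kderivation (derxy P Q).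
Proof.
split; [split|] => [a b|a b|c a]; rewrite /derxy.
- by rewrite !mderivD !mulrDr addrACA.
- rewrite !mderivM !mulrDr addrACA addrC; congr (_ + _).
  + by congr (_ + _); rewrite mulrCA.
  + by congr (_ + _); rewrite [_ * b]mulrC mulrCA.
- by rewrite !mderivZ -!scalerAr scalerDr.
Qed.

Lemma derxy_varx (k : fieldType) (P Q : {mpoly k[2]}) :
  derxy P Q (varx k) = P.
Proof.
rewrite /derxy /varx !mderivX !mnm1E /= scale0r mulr0 addr0 scale1r.
have -> : (U_(ord0) - U_(ord0))%MM = 0%MM :> 'X_{1..2}.
  by apply/mnmP => i; rewrite mnmBE subnn mnm0E.
by rewrite mpolyX0 mulr1.
Qed.

Lemma derxy_vary (k : fieldType) (P Q : {mpoly k[2]}) :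
  derxy P Q (vary k) = Q.
Proof.
rewrite /derxy /vary !mderivX !mnm1E /= scale0r mulr0 add0r scale1r.
have -> : (U_(ord_max) - U_(ord_max))%MM = 0%MM :> 'X_{1..2}.
  by apply/mnmP => i; rewrite mnmBE subnn mnm0E.
by rewrite mpolyX0 mulr1.
Qed.

Lemma kderivation_xy_unique (k : fieldType) (d e : {mpoly k[2]} -> {mpoly k[2]}) :
  is_kderivation d -> is_kderivation e ->
  d (varx k) = e (varx k) -> d (vary k) = e (vary k) -> d =1 e.
Proof.
move=> [[dD dM] dZ] [[eD eM] eZ] ex ey.
have d1 : d 1 = e 1.
  have h (f : {mpoly k[2]} -> {mpoly k[2]}) :
      (forall a b, f (a * b) = a * f b + b * f a) -> f 1 = 0.
    move=> fM; have := fM 1 1; rewrite !mul1r => /eqP.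
    by rewrite -subr_eq0 opprD addrA subrr add0r oppr_eq0 => /eqP.
  by rewrite !h.
have dX i : d 'X_i = e 'X_i.
  have [->//|->//] : i = ord0 \/ i = ord_max.
  by case: i => -[|[|//]] lti; [left|right]; apply: val_inj.
have dXn i n : d ('X_i ^+ n) = e ('X_i ^+ n).
  by elim: n => [|n IH]; rewrite ?expr0 // exprS dM eM IH dX.
have dXm m : d 'X_[m] = e 'X_[m].
  rewrite mpolyXE_id; elim/big_rec: _ => [//|i a _ IH].
  by rewrite dM eM IH dXn.
elim/mpolyind => [|c m p _ _ IH].
  by rewrite -[0](scale0r 1) dZ eZ !scale0r.
by rewrite dD eD IH dZ eZ dXm.
Qed.

(* Main.v *)
Require Import Defs.
From HB Require Import structures.
From mathcomp Require Import all_boot all_order all_algebra.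
From mathcomp Require Import mpoly.
From mathcomp Require Import ring zify.
From Stdlib Require Import Classical.

Set Implicit Arguments.
Unset Strict Implicit.

Import GRing.Theory.
Local Open Scope ring_scope.

(** Write [d] for the derivation.  A nonzero [d]-stable ideal contains a
    nonzero [f] of least degree in [y].  If that degree is [0] then [f] is a
    polynomial in [x], on which [d] is the ordinary derivative, and
    differentiating it often enough produces a nonzero constant.  Otherwise the
    pseudo-remainder of [d f] by [f] lies in the ideal and has smaller degree,
    hence vanishes; so [f] divides [a d f] for some nonzero [a] in [k[x]], and
    by Gauss's lemma [d] has a Darboux polynomial, an [f] with [d f = L f], of
    positive degree in [y].  Everything thus rests on [darboux_constant]: there
    is no such polynomial.

    To see this, give [x] the weight [s] and [y] the weight [t], so that
    [P = c1 x^t + c2 y^s] is homogeneous, and expand [d f = L f] from the top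
    weight downwards.  The two terms of [d] change weights by [- s] and [N - s],
    with [N = s (u + t + 1) - t > 0].  Let [w] be the weight of [f] and [b] its
    leading form with [x] set to [1], so that [P = c1 + c2 y^s] from here on.
    The top weight says that [b] divides [P b'] ([darboux_leading]): all roots
    of [b] are roots of [P].  The second piece of information comes from weight
    [- s]: there [L] has no component, since [L] is a polynomial.  Expanding the
    logarithm of [f] at infinity and comparing components of weight [- s] gives
    that
      [(w b - t y b') / (b P)]
    is, up to a nonzero constant, the derivative of a rational function of [y]
    ([darboux_subleading]).  Since [P b' = Q b] with [Q] a polynomial, this
    function is [(w P - t y Q) / P^2], and as [P] is squarefree its
    antiderivative must be [A / P] for a polynomial [A]
    ([quotient_antiderivative]).  Comparing the coefficients of [1] and [y^s]
    in [A' P - A P' = w P - t y Q] yields [w s = t deg b]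
    ([weight_degree_identity]).  But a form of weight [w] has degree at most
    [w / t] in [y], so [w s <= w], which with [s >= 2] forces [w = 0]: then [f]
    is constant.

    The calculations use [k[x][y]], that is [{poly {poly k}}] with [y] as the
    outer variable.  The weight is made visible by the substitution
    [x := T^s, y := y T^t] into [k[y][T]], where now [T] is the outer variable:
    leading forms become leading coefficients and expansion at infinity becomes
    pseudo-division by a polynomial in [T]. *)

(** * Rational antiderivatives with a squarefree denominator *)

Lemma deriv_eq0 (k : fieldType) (hk : [pchar k] =i pred0) (p : {poly k}) :
  p^`() = 0 -> (size p <= 1)%N.
Proof.
move=> dp0; apply/leq_sizeP => -[//|j] _.
have /eqP := congr1 (fun q : {poly k} => q`_j) dp0.
rewrite coef_deriv coef0 -mulr_natr mulf_eq0.
by move/pcharf0P: hk => ->; rewrite orbF => /eqP.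
Qed.

Lemma dvdp_deriv (k : fieldType) (hk : [pchar k] =i pred0) (p : {poly k}) :
  p %| p^`() -> (size p <= 1)%N.
Proof.
move=> dvd; apply: (deriv_eq0 hk); apply/eqP/negPn/negP => dp0.
have p0 : p != 0 by apply: contraNneq dp0 => ->; rewrite derivC.
by have := dvdp_leq dp0 dvd; rewrite leqNgt lt_size_deriv.
Qed.

(** A pole of order [m] of [U / V] is a pole of order [m + 1] of its derivative
    [B / P^2], whose poles have order at most [2]; so the poles of [U / V] are
    simple and lie at roots of [P].  Working with gcds instead of roots keeps
    the argument over [k]: [V1 = V / gcd(V, V')] is the radical of [V]. *)
Lemma antiderivative_denominator_dvdp (k : fieldType) (hk : [pchar k] =i pred0)
    (P U V B : {poly k}) :
  V != 0 -> coprimep U V -> coprimep P P^`() ->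
  P ^+ 2 * (U^`() * V - U * V^`()) = B * V ^+ 2 -> V %| P.
Proof.
move=> V0 copUV copP E.
pose G := gcdp V V^`().
have G0 : G != 0 by rewrite gcdp_eq0 negb_and V0.
have [V1 eV] := dvdpP _ _ (dvdp_gcdl V V^`()).
have [V2 eV'] := dvdpP _ _ (dvdp_gcdr V V^`()).
rewrite -/G in eV eV'.
have cop12 : coprimep V1 V2.
  have := @coprimep_div_gcd _ V V^`(); rewrite V0 => /(_ isT).
  by rewrite -/G {1}eV eV' !mulpK.
have V1V : V1 %| V by rewrite eV dvdp_mulr.
have V10 : V1 != 0 by apply: contraNneq V0 => h; rewrite eV h mul0r.
pose W := U^`() * V1 - U * V2.
(* [W / (V V1)] is the derivative of [U / V] in lowest terms. *)
have copV1W : coprimep V1 W.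
  apply/coprimepP => e eV1 eW.
  have: e %| U * V2 by rewrite -(dvdp_subr _ (dvdp_mull U^`() eV1)).
  rewrite Gauss_dvdpr => [eV2|].
    by move/coprimepP: cop12; apply.
  by rewrite coprimep_sym; apply: coprimep_dvdl copUV; apply: dvdp_trans V1V.
have E1 : P ^+ 2 * W = B * G * V1 ^+ 2.
  apply: (mulIf G0); rewrite -[LHS]mulrA.
  have -> : W * G = U^`() * V - U * V^`() by rewrite /W eV' [in RHS]eV; ring.
  by rewrite E {1}eV; ring.
have V1P : V1 %| P.
  rewrite -(@dvdp_pexp2r _ _ _ 2) // -(@Gauss_dvdpl _ _ W).
    by rewrite E1 dvdp_mull.
  exact: coprimep_expl.
have [P1 eP] := dvdpP _ _ V1P.
have copP1 : coprimep V1 P1.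
  apply/coprimepP => e eV1 eP1; move/coprimepP: copP; apply.
    by rewrite eP dvdp_mull.
  by rewrite eP derivM; apply: dvdp_add; [apply: dvdp_mull | apply: dvdp_mulr].
have E2 : P1 ^+ 2 * W = B * G.
  apply: (mulIf (expf_neq0 2 V10)); rewrite -E1 eP; ring.
(* It remains to see that the repeated part [G] of [V] is constant. *)
have copGV1 : coprimep G V1.
  apply/coprimepP => e eG eV1.
  have := dvdp_mull B eG; rewrite -E2 Gauss_dvdpr => [eW|].
    by move/coprimepP: copV1W; apply.
  by apply: coprimep_expr; apply: coprimep_dvdr copP1.
have : G %| G^`().
  rewrite -(@Gauss_dvdpr _ _ V1) //.
  have := dvdp_mull V2 (dvdpp G).
  by rewrite -eV' eV derivM (dvdp_addr _ (dvdp_mull _ (dvdpp G))) ?dvdp_addl // ?dvdp_mull.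
move/(dvdp_deriv hk) => sG.
have /size_poly1P[c c0 eG] : size G == 1%N.
  by rewrite eqn_leq sG lt0n size_poly_eq0.
by rewrite eV eG mulrC mul_polyC dvdpZl.
Qed.

(** The hypothesis says that [U / V] is an antiderivative of [B / P^2], the
    conclusion that it can be written as [A / P]. *)
Lemma quotient_antiderivative (k : fieldType) (hk : [pchar k] =i pred0)
    (P U V B : {poly k}) :
  V != 0 -> coprimep P P^`() ->
  P ^+ 2 * (U^`() * V - U * V^`()) = B * V ^+ 2 ->
  exists A, A^`() * P - A * P^`() = B.
Proof.
move=> V0 copP E.
pose D := gcdp U V.
have D0 : D != 0 by rewrite gcdp_eq0 negb_and V0 orbT.
have [U1 eU] := dvdpP _ _ (dvdp_gcdl U V).
have [V1 eV] := dvdpP _ _ (dvdp_gcdr U V).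
rewrite -/D in eU eV.
have V10 : V1 != 0 by apply: contraNneq V0 => h; rewrite eV h mul0r.
have cop : coprimep U1 V1.
  have := @coprimep_div_gcd _ U V; rewrite V0 orbT => /(_ isT).
  by rewrite -/D eU eV !mulpK.
have E1 : P ^+ 2 * (U1^`() * V1 - U1 * V1^`()) = B * V1 ^+ 2.
  apply: (mulIf (expf_neq0 2 D0)).
  transitivity (B * V ^+ 2); last by rewrite eV; ring.
  by rewrite -E eU eV !derivM; ring.
have [W eP] := dvdpP _ _ (antiderivative_denominator_dvdp hk V10 cop copP E1).
exists (U1 * W); apply: (mulIf (expf_neq0 2 V10)).
by rewrite -E1 eP !derivM; ring.
Qed.

(** Only the coefficients of [A] at exponents congruent to [1] modulo [s]
    matter.  The operator taking [A] to [A' P - A P'] links those at [m s + 1]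
    and [(m + 1) s + 1]; the right-hand side has degree at most [s], so descent
    from large [m] kills them all except the coefficient of [X], which the
    constant term then determines.  The coefficient of [X^s] gives the
    identity.  The numbers [w] and [n] stand for the weight and the degree of
    the leading form. *)
Lemma weight_degree_identity (k : fieldType) (hk : [pchar k] =i pred0)
    (s t w n : nat) (c1 c2 c : k) (A Q : {poly k}) :
  (2 <= s)%N -> c1 != 0 -> c2 != 0 -> c != 0 ->
  (size Q <= s)%N -> Q`_s.-1 = n%:R * c2 ->
  let P := c1%:P + c2%:P * 'X^s in
  A^`() * P - A * P^`() = c%:P * (w%:R * P - t%:R * ('X * Q)) ->
  (w * s = t * n)%N.
Proof.
move=> s2 c10 c20 c0.
have char0 m : (m%:R == 0 :> k) = (m == 0)%N by move/pcharf0P: hk => ->.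
case: s s2 => [//|r] r1 sQ Qs P E; rewrite ltnS in r1.
have dP : P^`() = (c2 *+ r.+1)%:P * 'X^r.
  rewrite /P derivD derivC add0r derivM derivC mul0r add0r derivXn /=.
  by rewrite polyCMn mulrnAr mulrnAl.
pose a m := A`_(m * r.+1).+1.
have coefE i : (A^`() * P - A * P^`())`_i
  = c1 * A^`()`_i + c2 * (if (i < r.+1)%N then 0 else A^`()`_(i - r.+1))
    - c2 *+ r.+1 * (if (i < r)%N then 0 else A`_(i - r)).
  have -> : A^`() * P = c1%:P * A^`() + c2%:P * (A^`() * 'X^(r.+1)).
    by rewrite /P; ring.
  rewrite dP [A * _]mulrCA coefB coefD !coefCM !coefMXn; congr (_ - _).
have PE i : P`_i = c1 * (i == 0)%:R + c2 * (i == r.+1)%:R.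
  by rewrite /P coefD coefC coefCM coefXn; case: (i == 0)%N; rewrite ?mulr1 ?mulr0.
have rhsE i : (c%:P * (w%:R * P - t%:R * ('X * Q)))`_i
  = c * (w%:R * P`_i - t%:R * (if i is j.+1 then Q`_j else 0)).
  rewrite coefCM coefB -!polyC_natr !coefCM coefXM; congr (_ * (_ - _ * _)).
  by case: i.
have a1 : a 0%N = c * w%:R.
  have := congr1 (fun p : {poly k} => p`_0) E; rewrite coefE rhsE PE /=.
  rewrite r1 !mulr0 coef_deriv mulr1n addr0 subr0 mulr1 addr0 subr0 => h.
  by apply: (mulfI c10); rewrite /a mul0n h; ring.
have step m : c1 * (a m.+1 *+ (m.+1 * r.+1).+1) + c2 * (a m *+ (m * r.+1).+1)
     - c2 *+ r.+1 * a m
   = c * (w%:R * c2 * (m == 0)%:R - t%:R * Q`_(r + m * r.+1)).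
  have := congr1 (fun p : {poly k} => p`_(m.+1 * r.+1)) E.
  rewrite coefE rhsE PE !coef_deriv mulSn -/(a m.+1).
  rewrite ltnNge leq_addr /= addKn -/(a m).
  have -> : (r.+1 + m * r.+1 < r)%N = false by lia.
  have -> : (r.+1 + m * r.+1 - r = (m * r.+1).+1)%N by lia.
  have -> : (r.+1 + m * r.+1 == r.+1) = (m == 0)%N by case: (m) => [|?]; lia.
  rewrite -/(a m) /a mulSn addSn /= mulr0 add0r => ->; ring.
have lem m : (m <= m * r.+1)%N by rewrite leq_pmulr.
(* The factor [(m - 1) s + 1] of the lower coefficient does not vanish. *)
have az j m : (0 < m)%N -> (size A <= m + j)%N -> a m = 0.
  elim: j m => [|j IH] m m0 sz.
    by rewrite /a nth_default // (leq_trans sz) // addn0 leqW.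
  have := step m; rewrite IH; [|lia|lia].
  rewrite (gtn_eqF m0) nth_default; last first.
    by rewrite (leq_trans sQ) //; have := lem m; lia.
  rewrite mul0rn mulr0 add0r !mulr0 subr0 mulr0.
  case: m m0 {sz} => [//|m] _.
  have -> : c2 * (a m.+1 *+ (m.+1 * r.+1).+1) - c2 *+ r.+1 * a m.+1
          = c2 * (a m.+1 * (m * r.+1).+1%:R).
    by rewrite -(mulr_natr (a _)) -(mulr_natr c2) mulSn -addnS natrD; ring.
  by move/eqP; rewrite !mulf_eq0 (negPf c20) char0 orbF => /eqP.
have := step 0%N; rewrite (az (size A)) // a1 mul0n addn0 /= in Qs *.
rewrite Qs mul0rn mulr0 add0r mulr1n mulr1 => h.
have : (w * r.+1)%:R - (t * n)%:R = 0 :> k.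
  apply: (mulfI (mulf_neq0 c0 c20)).
  rewrite !natrM mulr0.
  have := congr1 (fun z => - z + c * (w%:R * c2 - t%:R * (n%:R * c2))) h.
  rewrite addNr -mulr_natr => <-; ring.
move=> {}h; apply/eqP.
case/orP: (leq_total (w * r.+1) (t * n)) => le; move: h.
  rewrite -opprB -natrB // => /eqP; rewrite oppr_eq0 char0; lia.
rewrite -natrB // => /eqP; rewrite char0; lia.
Qed.

(** * Gauss's lemma and derivations of k[x][y] *)

Lemma irreducible_factor (k : fieldType) (a : {poly k}) :
  (1 < size a)%N -> exists2 p, irreducible_poly p & p %| a.
Proof.
have [n] := ubnP (size a); elim: n a => // n IH a sa a1.
have [irr|nirr] := classic (irreducible_poly a); first by exists a.
have [q [q1 qa neq]] : exists q : {poly k}, [/\ size q != 1, q %| a & ~ q %= a].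
  apply: NNPP => H; apply: nirr; split=> // q q1 qa.
  by apply: NNPP => neq; apply: H; exists q.
have a0 : a != 0 by rewrite -size_poly_gt0 (ltn_trans _ a1).
have q0 : q != 0 by apply: contraNneq a0 => h; move: qa; rewrite h dvd0p.
have sq : (size q < size a)%N.
  rewrite ltn_neqAle dvdp_leq // andbT; apply/negP => /eqP sqa.
  by apply: neq; rewrite -(dvdp_size_eqp qa) sqa.
have [|| p irr pq] := IH q; first by apply: leq_trans sq _.
  by rewrite ltn_neqAle eq_sym q1 size_poly_gt0.
by exists p => //; apply: dvdp_trans qa.
Qed.

(** Divisibility of a product by [p] passes to the product of the leading
    coefficients, so one factor can be shortened by its leading term without
    leaving the situation. *)
Lemma gauss_lemma (k : fieldType) (p : {poly k}) (q f h : {poly {poly k}}) :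
  irreducible_poly p -> q * f = p *: h ->
  (exists q1, q = p *: q1) \/ (exists f1, f = p *: f1).
Proof.
move=> irr; have p0 := irredp_neq0 irr.
have [n] := ubnP (size q + size f); elim: n q f h => // n IH q f h.
have drop_lead (g : {poly {poly k}}) : g != 0 ->
    (size (g - lead_coef g *: 'X^((size g).-1))%R < size g)%N.
  move=> g0; rewrite -[X in (_ < X)%N]prednK ?size_poly_gt0 // ltnS.
  apply/leq_sizeP => j; rewrite leq_eqVlt => /predU1P[<-|lt].
    by rewrite coefB coefZ coefXn eqxx mulr1 subrr.
  rewrite coefB coefZ coefXn (gtn_eqF lt) mulr0 subr0 nth_default //.
  by move: lt; rewrite -[(size g)]prednK ?size_poly_gt0.
rewrite ltnS => sn E.
have [->|q0] := eqVneq q 0; first by left; exists 0; rewrite scaler0.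
have [->|f0] := eqVneq f 0; first by right; exists 0; rewrite scaler0.
have : p %| lead_coef q * lead_coef f by rewrite -lead_coefM E lead_coefZ dvdp_mulr.
have [/dvdpP[a ea] _|npq] := boolP (p %| lead_coef q); last first.
  rewrite Gauss_dvdpr ?irreducible_poly_coprime // => /dvdpP[a ea].
  pose m := lead_coef f *: 'X^((size f).-1).
  have em : m = p *: (a *: 'X^((size f).-1)) by rewrite /m ea scalerA mulrC.
  have [||[q1 ->]|[f1 e1]] := IH q (f - m) (h - q * (a *: 'X^((size f).-1))).
  - by apply: leq_trans sn; rewrite ltn_add2l drop_lead.
  - by rewrite mulrBr E em -scalerAr scalerBr.
  - by left; exists q1.
  by right; exists (f1 + a *: 'X^((size f).-1)); rewrite scalerDr -em -e1 subrK.
pose m := lead_coef q *: 'X^((size q).-1).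
have em : m = p *: (a *: 'X^((size q).-1)) by rewrite /m ea scalerA mulrC.
have [||[q1 e1]|[f1 ->]] := IH (q - m) f (h - (a *: 'X^((size q).-1)) * f).
- by apply: leq_trans sn; rewrite ltn_add2r drop_lead.
- by rewrite mulrBl E em -scalerAl scalerBr.
- by left; exists (q1 + a *: 'X^((size q).-1)); rewrite scalerDr -em -e1 subrK.
by right; exists f1.
Qed.

(** The partial derivative in the inner variable. *)
Definition deriv_coefs (R : comNzRingType) (f : {poly {poly R}}) :=
  map_poly (@deriv R) f.

Lemma deriv_coefsD (R : comNzRingType) : {morph @deriv_coefs R : f g / f + g}.
Proof. by move=> f g; apply/polyP => i; rewrite coefD !coef_map coefD /= derivD. Qed.

Lemma deriv_coefsM (R : comNzRingType) (f g : {poly {poly R}}) :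
  deriv_coefs (f * g) = f * deriv_coefs g + g * deriv_coefs f.
Proof.
apply/polyP => i; rewrite coefD coef_map /= coefM raddf_sum.
rewrite coefM [g * _]mulrC coefM -big_split; apply: eq_bigr => j _.
by rewrite /= derivM !coef_map addrC.
Qed.

Lemma deriv_coefsC (R : comNzRingType) (c : {poly R}) :
  deriv_coefs c%:P = (c^`())%:P.
Proof. by rewrite /deriv_coefs map_polyC. Qed.

Lemma deriv_coefsX (R : comNzRingType) : deriv_coefs ('X : {poly {poly R}}) = 0.
Proof.
apply/polyP => i; rewrite coef_map coefX coef0 /=.
by rewrite -polyC_natr derivC.
Qed.

(** With [x] the inner and [y] the outer variable: the derivation sending
    [x] to [1] and [y] to [Q]. *)
Definition bideriv (R : comNzRingType) (Q f : {poly {poly R}}) :=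
  deriv_coefs f + Q * f^`().

Lemma biderivM (R : comNzRingType) (Q f g : {poly {poly R}}) :
  bideriv Q (f * g) = f * bideriv Q g + g * bideriv Q f.
Proof. by rewrite /bideriv deriv_coefsM derivM; ring. Qed.

Lemma biderivD (R : comNzRingType) (Q f g : {poly {poly R}}) :
  bideriv Q (f + g) = bideriv Q f + bideriv Q g.
Proof. by rewrite /bideriv deriv_coefsD derivD; ring. Qed.

Lemma biderivC (R : comNzRingType) (Q : {poly {poly R}}) (c : {poly R}) :
  bideriv Q c%:P = (c^`())%:P.
Proof. by rewrite /bideriv deriv_coefsC derivC mulr0 addr0. Qed.

(** If [f] divides [a d f], a prime factor [p] of [a] can be removed: by Gauss's
    lemma it divides the cofactor, or it divides [f] and can be taken out of
    [f], which alters the cofactor by the logarithmic derivative of [p].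
    Neither step changes the degree of [f] in the outer variable. *)
Lemma darboux_clear_denominator (k : fieldType) (Q : {poly {poly k}})
    (a : {poly k}) (f q : {poly {poly k}}) :
  a != 0 -> f != 0 -> a *: bideriv Q f = q * f ->
  exists g r : {poly {poly k}}, [/\ size g = size f & bideriv Q g = r * g].
Proof.
have [n] := ubnP (size a + size (lead_coef f)).
elim: n a f q => // n IH a f q; rewrite ltnS => sn a0 f0 E.
have [sa|sa] := leqP (size a) 1.
  have /size_poly1P[c c0 ea] : size a == 1%N by rewrite eqn_leq sa size_poly_gt0.
  exists f, ((c^-1)%:P *: q); split=> //.
  by rewrite -scalerAl -E ea scalerA -polyCM mulVf // scale1r.
have [p irr /dvdpP[b eb]] := irreducible_factor sa.
have p0 := irredp_neq0 irr.
have pP0 : p%:P != 0 :> {poly {poly k}} by rewrite polyC_eq0.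
have b0 : b != 0 by apply: contraNneq a0 => h; rewrite eb h mul0r.
have sp : (1 < size p)%N by case: irr.
have szM (c : {poly k}) : c != 0 -> (size c < size (p * c)%R)%N.
  move=> c0; rewrite size_mul //.
  by case: (size p) sp => [|[|m]] // _; rewrite addSn /= addSn ltnS leq_addl.
have E1 : q * f = p *: (b *: bideriv Q f) by rewrite -E eb scalerA mulrC.
have [[q1 eq1]|[f1 ef]] := gauss_lemma irr E1.
  apply: (IH b f q1) => //.
    by apply: leq_trans sn; rewrite ltn_add2r eb mulrC szM.
  by apply: (mulfI pP0); rewrite !mul_polyC -E1 eq1 scalerAl.
have f10 : f1 != 0 by apply: contraNneq f0 => h; rewrite ef h scaler0.
have sf : size f = size f1 by rewrite ef size_scale.
rewrite sf; apply: (IH a f1 (q - (b * p^`())%:P)) => //.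
  apply: leq_trans sn; rewrite ltn_add2l ef lead_coefZ szM // lead_coef_eq0 //.
apply: (mulfI pP0).
move: E; rewrite ef -!mul_polyC biderivM biderivC eb !polyCM => E.
have -> : p%:P * (b%:P * p%:P * bideriv Q f1)
  = b%:P * p%:P * (p%:P * bideriv Q f1 + f1 * (p^`())%:P)
    - b%:P * p%:P * (f1 * (p^`())%:P) by ring.
by rewrite E; ring.
Qed.

(** * Leading coefficients and the expansion at infinity *)

(** A weak leading coefficient: [c] may be zero, which lets the bound on the
    degree and the coefficient at that bound be computed together through sums
    and products. *)
Definition top_coef (R : nzRingType) (n : nat) (p : {poly R}) (c : R) :=
  (size p <= n.+1)%N /\ p`_n = c.

Lemma top_coefD (R : nzRingType) n (p q : {poly R}) c e :
  top_coef n p c -> top_coef n q e -> top_coef n (p + q) (c + e).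
Proof.
move=> [sp <-] [sq <-]; split; last by rewrite coefD.
by rewrite (leq_trans (size_polyD _ _)) // geq_max sp.
Qed.

Lemma top_coefN (R : nzRingType) n (p : {poly R}) c :
  top_coef n p c -> top_coef n (- p) (- c).
Proof. by move=> [sp <-]; split; rewrite ?size_polyN ?coefN. Qed.

Lemma top_coefB (R : nzRingType) n (p q : {poly R}) c e :
  top_coef n p c -> top_coef n q e -> top_coef n (p - q) (c - e).
Proof. by move=> Hp Hq; apply: top_coefD => //; apply: top_coefN. Qed.

Lemma top_coefM (R : nzRingType) m n (p q : {poly R}) c e :
  top_coef m p c -> top_coef n q e -> top_coef (m + n) (p * q) (c * e).
Proof.
move=> [sp <-] [sq <-]; split.
  apply: leq_trans (size_polyMleq _ _) _.
  by have := leq_add sp sq; rewrite addSn addnS; case: (size p + size q)%N.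
rewrite coefM (bigD1 (inord m)) //= inordK ?ltnS ?leq_addr // addKn.
rewrite big1 ?addr0 // => i; rewrite -val_eqE /= inordK ?ltnS ?leq_addr // => ne.
case: (ltngtP i m) ne => // lt _; last by rewrite (nth_default _ (leq_trans sp lt)) mul0r.
rewrite [q`_ _]nth_default ?mulr0 // (leq_trans sq) //.
by have := ltn_ord i; lia.
Qed.

Lemma top_coefC (R : nzRingType) (c : R) : top_coef 0 c%:P c.
Proof. by split; rewrite ?coefC ?eqxx // size_polyC leq_b1. Qed.

Lemma top_coefCM (R : nzRingType) n (p : {poly R}) a c :
  top_coef n p c -> top_coef n (a%:P * p) (a * c).
Proof. exact: (top_coefM (top_coefC a)). Qed.

Lemma top_coef_lead (R : nzRingType) (p : {poly R}) :
  top_coef (size p).-1 p (lead_coef p).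
Proof. by split; rewrite ?leqSpred. Qed.

Lemma top_coef_deriv (R : nzRingType) n (p : {poly R}) c :
  top_coef n p c -> top_coef n ('X * p^`()) (c *+ n).
Proof.
move=> [sp <-]; split; last first.
  by rewrite coefXM; case: n sp => [|n] sp; rewrite ?mulr0n //= coef_deriv.
apply/leq_sizeP => -[|j] // jn; rewrite coefXM /= coef_deriv nth_default ?mul0rn //.
exact: leq_trans jn.
Qed.

Lemma top_coef_coefs (R : comNzRingType) n (p : {poly {poly R}}) c :
  top_coef n p c -> top_coef n (deriv_coefs p) c^`().
Proof.
move=> [sp <-]; split; last by rewrite coef_map.
exact: leq_trans (size_poly _ _) sp.
Qed.

Lemma deriv_coefs_deriv (R : comNzRingType) (p : {poly {poly R}}) :
  deriv_coefs p^`() = (deriv_coefs p)^`().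
Proof. by apply/polyP => i; rewrite coef_map !coef_deriv coef_map /= derivMn. Qed.

Lemma deriv_coefsXn (R : comNzRingType) n : deriv_coefs ('X^n : {poly {poly R}}) = 0.
Proof.
elim: n => [|n IH]; first by rewrite expr0 deriv_coefsC derivC polyC0.
by rewrite exprS deriv_coefsM IH deriv_coefsX !mulr0 addr0.
Qed.

Lemma top_coef_factor (R : idomainType) m n (p q : {poly R}) c :
  q != 0 -> size q = n.+1 -> top_coef (m + n) (p * q) c ->
  top_coef m p p`_m /\ p`_m * lead_coef q = c.
Proof.
move=> q0 sq [spq cpq].
have Hp : top_coef m p p`_m.
  split=> //; have [->|p0] := eqVneq p 0; first by rewrite size_poly0.
  by move: spq; rewrite size_mul // sq addnS /= -addSn leq_add2r.
split=> //; rewrite -cpq.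
have Hq : top_coef n q (lead_coef q) by split; rewrite ?lead_coefE sq.
by have [_ ->] := top_coefM Hp Hq.
Qed.

(** The equation [E] below is [d f = L f] multiplied by [s T^s], after the
    weighted substitution: [g] is the image of [f], and [M] is [s T^s] times
    that of [L], whence [M`_0 = 0].  The outer variable is [T], the inner one [y]. *)
Section Asymptotics.

Variables (k : fieldType) (s t N : nat) (P : {poly k}).
Variables (g M : {poly {poly k}}).
Hypotheses (g0 : g != 0) (N0 : (0 < N)%N) (M0 : M`_0 = 0).
Hypothesis E : 'X * g^`() - t%:R * 'X%:P * deriv_coefs g
   + s%:R * 'X^N * P%:P * deriv_coefs g = M * g.

Let w := (size g).-1.
Let b := lead_coef g.

Let natC n : n%:R = (n%:R : {poly k})%:P.
Proof. by rewrite -polyC_natr. Qed.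

Let gw : size g = w.+1.
Proof. by rewrite /w prednK // size_poly_gt0. Qed.

Let gtop : top_coef w g b.
Proof. exact: top_coef_lead. Qed.

Lemma darboux_leading : s%:R * P * b^`() = M`_N * b.
Proof.
have H n (p : {poly {poly k}}) c : top_coef n p c -> top_coef (N + n) p 0.
  move=> [sp _]; split; first by rewrite (leq_trans sp) // ltnS leq_addl.
  by rewrite nth_default // (leq_trans sp) // -[n.+1]add1n leq_add2r.
have HXN : top_coef N ('X^N : {poly {poly k}}) 1.
  by split; rewrite ?size_polyXn // coefXn eqxx.
have top : top_coef (N + w) (M * g) (0 - 0 + s%:R * P * b^`()).
  rewrite -E; apply: top_coefD.
    apply: top_coefB; apply: H; first exact: top_coef_deriv gtop.
    rewrite natC -polyCM; apply: top_coefCM; exact: top_coef_coefs gtop.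
  have -> : s%:R * 'X^N * P%:P * deriv_coefs g
     = (s%:R * P)%:P * ('X^N * deriv_coefs g) by rewrite natC polyCM; ring.
  apply: top_coefCM; rewrite -[b^`()]mul1r; apply: top_coefM => //.
  exact: top_coef_coefs gtop.
by have [_] := top_coef_factor g0 gw top; rewrite subrr add0r => ->.
Qed.

(** Dividing [E] by [g], the coefficient of [T^0] in the expansion at infinity
    reads
      [w - t y b' / b + s P [T^-N](g_y / g) = 0],
    where [w] is the [T]-degree and [b] the leading coefficient of [g].
    Logarithmic derivatives commute with mixed differentiation, whence
    [- N [T^-N](g_y / g)] is the [y]-derivative of [[T^-N](T g_T / g)].  That
    last coefficient is [q0 / G], with [q0] the constant coefficient of the
    pseudo-quotient of [T^N (T g_T)] by [g] and [G] the power of [b] that the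
    pseudo-division introduces.  The identity is proved without denominators. *)
Lemma darboux_subleading :
  exists q0 G : {poly k}, G != 0 /\
    s%:R * P * (G * q0^`() - G^`() * q0) * b
      = N%:R * G ^+ 2 * (w%:R * b - t%:R * 'X * b^`()).
Proof.
pose X := 'X * g^`(); pose Y := deriv_coefs g; pose Z := deriv_coefs X.
pose dX := 'X * X^`(); pose dM := 'X * M^`().
pose G := b ^+ scalp ('X^N * X) g.
pose q := ('X^N * X) %/ g; pose r := ('X^N * X) %% g.
have eZ : Z = 'X * Y^`().
  by rewrite /Z /X deriv_coefsM deriv_coefsX mulr0 addr0 deriv_coefs_deriv.
have G0 : G != 0 by rewrite expf_neq0 // lead_coef_eq0.
have V : G%:P * 'X^N * X = q * g + r.
  by rewrite -mulrA mul_polyC /G /q /r -Pdiv.Idomain.divp_eq.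
have Vy : G^`()%:P * 'X^N * X + G%:P * 'X^N * Z
   = deriv_coefs q * g + q * Y + deriv_coefs r.
  have dGX : deriv_coefs (G%:P * 'X^N * X)
     = G^`()%:P * 'X^N * X + G%:P * 'X^N * Z.
    by rewrite deriv_coefsM (deriv_coefsM G%:P) deriv_coefsC deriv_coefsXn -/Z; ring.
  by rewrite -dGX V deriv_coefsD deriv_coefsM -/Y [g * _]mulrC [q * Y + _]addrC.
have E1 : dX - t%:R * 'X%:P * Z
   + s%:R * P%:P * 'X^N * (N%:R * Y + Z) = dM * g + M * X.
  have E' : X - (t%:R * 'X)%:P * Y + (s%:R * P)%:P * ('X^N * Y) = M * g.
    by rewrite -E !polyCM -!natC -/X -/Y; ring.
  have derivCM (c : {poly k}) (p : {poly {poly k}}) : (c%:P * p)^`() = c%:P * p^`().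
    by rewrite derivM derivC mul0r add0r.
  have := congr1 (fun p => 'X * p^`()) E'.
  rewrite derivD derivB !derivCM (derivM M) (derivM 'X^N) derivXn !polyCM -!natC.
  have eN : 'X^N = 'X * 'X^(N.-1) :> {poly {poly k}} by rewrite -exprS prednK.
  have -> : 'X * (M^`() * g + M * g^`()) = dM * g + M * X.
    by rewrite /dM [in RHS]/X; ring.
  by move=> <-; rewrite eZ /dX -(mulr_natr 'X^(N.-1)) eN; ring.
pose form := X ^+ 2 - t%:R * 'X%:P * (X * Y) - g * (dX - N%:R * X)
   + t%:R * 'X%:P * (g * Z - N%:R * (g * Y)).
pose rest := G%:P * (g * deriv_coefs r - r * Y) - G^`()%:P * (r * g).
pose A := s%:R * P%:P * (G%:P * deriv_coefs q - G^`()%:P * q)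
   - G%:P ^+ 2 * (dM - N%:R * M).
(* An exact consequence of [E], its [T]-derivative [E1], the pseudo-division
   [V] and its [y]-derivative [Vy].  The right-hand side has [T]-degree at most
   [2 w], so [A] has no positive power of [T], and its constant coefficient is
   found by comparing the coefficients of [T^(2 w)]. *)
have key : A * g ^+ 2 = G%:P ^+ 2 * form - s%:R * P%:P * rest.
  apply/eqP; rewrite -subr_eq0; apply/eqP.
  have h0 : X - t%:R * 'X%:P * Y + s%:R * 'X^N * P%:P * Y - M * g = 0.
    by rewrite /X /Y E subrr.
  have h1 : dX - t%:R * 'X%:P * Z + s%:R * P%:P * 'X^N * (N%:R * Y + Z)
     - (dM * g + M * X) = 0 by rewrite E1 subrr.
  have h2 : q * g + r - G%:P * 'X^N * X = 0 by rewrite V subrr.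
  have h3 : deriv_coefs q * g + q * Y + deriv_coefs r
     - (G^`()%:P * 'X^N * X + G%:P * 'X^N * Z) = 0 by rewrite Vy subrr.
  transitivity (s%:R * P%:P * G%:P * g * (deriv_coefs q * g + q * Y + deriv_coefs r
     - (G^`()%:P * 'X^N * X + G%:P * 'X^N * Z))
   - s%:R * P%:P * (G%:P * Y + G^`()%:P * g) * (q * g + r - G%:P * 'X^N * X)
   + G%:P ^+ 2 * g * (dX - t%:R * 'X%:P * Z
        + s%:R * P%:P * 'X^N * (N%:R * Y + Z) - (dM * g + M * X))
   - G%:P ^+ 2 * (N%:R * g + X) *
      (X - t%:R * 'X%:P * Y + s%:R * 'X^N * P%:P * Y - M * g)); last first.
    by rewrite h0 h1 h2 h3 !mulr0; ring.
  by rewrite /A /rest /form; ring.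
have tX : top_coef w X (b *+ w) by apply: top_coef_deriv.
have tY : top_coef w Y b^`() by apply: top_coef_coefs.
have tZ : top_coef w Z (b *+ w)^`() by apply: top_coef_coefs.
have tdX : top_coef w dX (b *+ w *+ w) by apply: top_coef_deriv.
have tr : top_coef w r 0.
  have sr : (size r <= w)%N by rewrite -ltnS -gw Pdiv.Idomain.ltn_modpN0.
  by split; [apply: leq_trans sr _|rewrite nth_default].
have tdr := top_coef_coefs tr.
have tform : top_coef (w + w) form ((b *+ w) * (b *+ w)
   - t%:R * 'X * ((b *+ w) * b^`()) - b * (b *+ w *+ w - N%:R * (b *+ w))
   + t%:R * 'X * (b * (b *+ w)^`() - N%:R * (b * b^`()))).
  rewrite /form expr2 !natC -!polyCM.
  apply: top_coefD; last first.
    apply/top_coefCM/top_coefB; first exact: top_coefM.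
    exact/top_coefCM/top_coefM.
  apply: top_coefB; last by apply: top_coefM => //; apply/top_coefB/top_coefCM.
  by apply: top_coefB; first exact: top_coefM; apply/top_coefCM/top_coefM.
have trest : top_coef (w + w) rest (G * (b * 0^`() - 0 * b^`()) - G^`() * (0 * b)).
  apply: top_coefB; apply: top_coefCM; last exact: top_coefM.
  by apply: top_coefB; apply: top_coefM.
have [_ hA] : top_coef 0 A A`_0 /\ A`_0 * lead_coef (g ^+ 2)
   = G ^+ 2 * (N%:R * b * (w%:R * b - t%:R * 'X * b^`())).
  apply: (@top_coef_factor _ 0 (w + w)); first by rewrite expf_neq0.
    by rewrite expr2 size_mul // gw addnS.
  rewrite add0n key.
  have -> : G ^+ 2 * (N%:R * b * (w%:R * b - t%:R * 'X * b^`()))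
    = G ^+ 2 * ((b *+ w) * (b *+ w)
   - t%:R * 'X * ((b *+ w) * b^`()) - b * (b *+ w *+ w - N%:R * (b *+ w))
   + t%:R * 'X * (b * (b *+ w)^`() - N%:R * (b * b^`())))
    - s%:R * P * (G * (b * 0^`() - 0 * b^`()) - G^`() * (0 * b)).
    by rewrite derivMn derivC; ring.
  by rewrite -polyC_exp natC -polyCM; apply: top_coefB; apply: top_coefCM.
exists q`_0, G; split=> //.
have b0 : b != 0 by rewrite lead_coef_eq0.
apply: (mulIf b0).
have A0 : A`_0 = s%:R * P * (G * (q`_0)^`() - G^`() * q`_0).
  rewrite /A -polyC_exp !natC -polyCM coefB !coefCM !coefB !coefCM coef_map /=.
  by rewrite coefXM M0 mulr0 subr0 mulr0 subr0.
by move: hA; rewrite expr2 lead_coefM -/b A0 => hA2; rewrite -[LHS]mulrA hA2; ring.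
Qed.

End Asymptotics.

(** * Weights and the absence of Darboux polynomials *)

(** Used to compare two ways of differentiating the image of a polynomial under
    a ring morphism [psi]: both are derivations along [psi], and need only be
    compared on the constants and on the two variables. *)
Lemma derivation_along_unique (k : fieldType) (B : comPzRingType)
    (psi e1 e2 : {poly {poly k}} -> B) :
  {morph e1 : a b / a + b} -> {morph e2 : a b / a + b} ->
  (forall a b, e1 (a * b) = psi a * e1 b + psi b * e1 a) ->
  (forall a b, e2 (a * b) = psi a * e2 b + psi b * e2 a) ->
  (forall c : k, e1 c%:P%:P = e2 c%:P%:P) -> e1 'X%:P = e2 'X%:P ->
  e1 'X = e2 'X -> e1 =1 e2.
Proof.
move=> D1 D2 L1 L2 ec ex ey.
have inner (p : {poly k}) : e1 p%:P = e2 p%:P.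
  elim/poly_ind: p => [|p c IH]; first by rewrite -polyC0 ec.
  by rewrite polyCD polyCM D1 D2 L1 L2 ec ex IH.
elim/poly_ind => [|p c IH]; first by rewrite -polyC0 inner.
by rewrite D1 D2 L1 L2 inner ey IH.
Qed.

Section WeightedSubstitution.

Variables (k : fieldType) (s t : nat).
Hypothesis s0 : (0 < s)%N.

(** The substitution [x := T^s], [y := y T^t], from [k[x][y]] to [k[y][T]]. *)
Definition weightedx : {poly k} -> {poly {poly k}} :=
  comp_poly 'X^s \o map_poly polyC.
HB.instance Definition _ := GRing.RMorphism.on weightedx.

Definition weighted : {poly {poly k}} -> {poly {poly k}} :=
  horner_eval ('X%:P * 'X^t) \o map_poly weightedx.
HB.instance Definition _ := GRing.RMorphism.on weighted.

Lemma weightedC (p : {poly k}) : weighted p%:P = weightedx p.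
Proof. by rewrite /weighted /= map_polyC /horner_eval hornerC. Qed.

Lemma weightedCC (c : k) : weighted c%:P%:P = c%:P%:P.
Proof. by rewrite weightedC /weightedx /= map_polyC comp_polyC. Qed.

Lemma weighted_x : weighted 'X%:P = 'X^s.
Proof. by rewrite weightedC /weightedx /= map_polyX comp_polyX. Qed.

Lemma weighted_y : weighted 'X = 'X%:P * 'X^t.
Proof. by rewrite /weighted /= map_polyX /horner_eval hornerX. Qed.

Lemma coef_weighted f w j :
  (weighted f)`_w`_j =
  if (t * j <= w)%N && (s %| w - t * j)%N then f`_j`_((w - t * j) %/ s) else 0.
Proof.
have -> : weighted f =
    \sum_(i < size f) weightedx f`_i * ('X^i)%:P * 'X^(t * i).
  rewrite /weighted /= /horner_eval (@horner_coef_wide _ (size f)) ?size_poly //.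
  apply: eq_bigr => i _.
  by rewrite coef_map exprMn -exprM -polyC_exp mulrA.
pose c i := if (t * i <= w)%N && (s %| w - t * i)%N
            then f`_i`_((w - t * i) %/ s) else 0.
have -> : (\sum_(i < size f) weightedx f`_i * ('X^i)%:P * 'X^(t * i))`_w
    = \poly_(i < size f) c i.
  rewrite coef_sum poly_def; apply: eq_bigr => i _.
  rewrite coefMXn /c ltnNge; case: (t * i <= w)%N; last by rewrite scale0r.
  rewrite coefMC /weightedx /= coef_comp_poly_Xn // coef_map /=.
  by case: (s %| _)%N; rewrite ?mul_polyC // mul0r scale0r.
rewrite coef_poly; case: ltnP => // le.
by rewrite (nth_default _ le) coef0 if_same.
Qed.

(** The coefficient of [T^w] collects the monomials [x^i y^j] with
    [s i + t j = w], whose degree in [y] is at most [w / t]. *)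
Lemma size_coef_weighted f w : (t * (size ((weighted f)`_w)%R).-1 <= w)%N.
Proof.
have [->|n0] := eqVneq (weighted f)`_w 0; first by rewrite size_poly0 muln0.
have : lead_coef (weighted f)`_w != 0 by rewrite lead_coef_eq0.
by rewrite /lead_coef coef_weighted; case: (t * _ <= w)%N => //; rewrite eqxx.
Qed.

Lemma size_weighted (f : {poly {poly k}}) : (0 < t)%N -> (1 < size f)%N -> (1 < size (weighted f))%N.
Proof.
move=> t0 sf.
pose j := (size f).-1; pose i := (size (lead_coef f)).-1.
have f0 : f != 0 by rewrite -size_poly_gt0 ltnW.
have c0 : (weighted f)`_(s * i + t * j)`_j != 0.
  rewrite coef_weighted leq_addl addnK dvdn_mulr //= mulKn //.
  by rewrite -[f`_j]/(lead_coef f) -[_`_i]/(lead_coef _) !lead_coef_eq0.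
rewrite ltnNge; apply: contraNN c0 => sw.
rewrite [(weighted f)`_(s * i + t * j)]nth_default ?coef0 //.
have j0 : (0 < j)%N by rewrite /j; case: (size f) sf => [|[|]].
by apply: leq_trans sw _; rewrite addn_gt0 !muln_gt0 t0 j0 orbT.
Qed.

Lemma deriv_coefs_weighted f :
  deriv_coefs (weighted f) = 'X^t * weighted f^`().
Proof.
move: f; apply: (@derivation_along_unique _ _ weighted) => [a b|a b|a b|a b|c||].
- by rewrite rmorphD deriv_coefsD.
- by rewrite derivD rmorphD mulrDr.
- by rewrite rmorphM deriv_coefsM.
- by rewrite derivM rmorphD !rmorphM; ring.
- by rewrite weightedCC deriv_coefsC !derivC polyC0 rmorph0 mulr0.
- by rewrite weighted_x deriv_coefsXn derivC rmorph0 mulr0.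
by rewrite weighted_y deriv_coefsM deriv_coefsXn deriv_coefsC !derivX !rmorph1 mulr0 add0r.
Qed.

(** Euler's identity for weighted homogeneous polynomials. *)
Lemma euler_weighted f :
  'X * (weighted f)^`()
  = s%:R * 'X^s * weighted (deriv_coefs f)
    + t%:R * 'X%:P * deriv_coefs (weighted f).
Proof.
rewrite deriv_coefs_weighted.
move: f; apply: (@derivation_along_unique _ _ weighted) => [a b|a b|a b|a b|c||].
- by rewrite rmorphD derivD mulrDr.
- by rewrite derivD deriv_coefsD !rmorphD; ring.
- by rewrite rmorphM derivM; ring.
- by rewrite derivM deriv_coefsM !rmorphD !rmorphM; ring.
- by rewrite weightedCC deriv_coefsC !derivC polyC0 rmorph0 !mulr0 addr0.
- rewrite weighted_x deriv_coefsC derivX !rmorph1 derivC rmorph0 !mulr0 addr0.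
  by rewrite derivXn mulrnAr -exprS prednK // mulr_natl mulr1.
rewrite weighted_y deriv_coefsX derivX rmorph0 !rmorph1 derivM derivC derivXn.
case: t => [|m]; first by rewrite mulr0n; ring.
by rewrite /= -(mulr_natr 'X^m) exprS; ring.
Qed.

End WeightedSubstitution.

Definition planar_field (k : fieldType) (s t u : nat) (c1 c2 : k) :
    {poly {poly k}} :=
  'X%:P ^+ u * (c1%:P%:P * 'X%:P ^+ t + c2%:P%:P * 'X ^+ s).

(** With [w s = t n] for the weight [w] and the degree [n] of the leading form,
    the bound [t n <= w] leaves no room for [w > 0] once [s >= 2]. *)
Lemma darboux_constant (k : fieldType) (hk : [pchar k] =i pred0) (s t u : nat)
    (c1 c2 : k) (f L : {poly {poly k}}) :
  (2 <= s)%N -> (1 <= t)%N -> c1 != 0 -> c2 != 0 ->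
  bideriv (planar_field s t u c1 c2) f = L * f -> (size f <= 1)%N.
Proof.
move=> s2 t1 c10 c20 df; rewrite leqNgt; apply/negP => sf.
have char0 m : (m%:R == 0 :> k) = (m == 0)%N by move/pcharf0P: hk => ->.
have s0 : (0 < s)%N by apply: ltnW.
(* The difference between the weights by which the two terms of the derivation
   shift a polynomial. *)
pose N := (s * (u + t + 1) - t)%N.
have eN : (N + t = s + (s * u + s * t))%N by rewrite /N; nia.
have N0 : (0 < N)%N by rewrite /N; nia.
pose g := weighted s t f.
have sg : (1 < size g)%N by apply: size_weighted.
have g0 : g != 0 by rewrite -size_poly_gt0 ltnW.
pose M := s%:R * 'X^s * weighted s t L.
have M0 : M`_0 = 0.
  by rewrite /M -mulrA -polyC_natr coefCM coefXnM s0 mulr0.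
pose P : {poly k} := c1%:P + c2%:P * 'X^s.
have E : 'X * g^`() - t%:R * 'X%:P * deriv_coefs g
   + s%:R * 'X^N * P%:P * deriv_coefs g = M * g.
  have eQ : weighted s t (planar_field s t u c1 c2) = 'X^(s * u + s * t) * P%:P.
    rewrite /planar_field rmorphM rmorphD !rmorphM !rmorphXn /=.
    rewrite !weightedCC weighted_x weighted_y -!exprM exprMn -exprM.
    by rewrite /P polyCD polyCM polyC_exp exprD [(t * s)%N]mulnC; ring.
  rewrite /g euler_weighted // addrK /M -[RHS]mulrA -(rmorphM (weighted s t)) -df.
  rewrite (rmorphD (weighted s t)) (rmorphM (weighted s t)) /= eQ deriv_coefs_weighted.
  have -> : s%:R * 'X^N * P%:P * ('X^t * weighted s t f^`())
    = s%:R * 'X^(N + t) * P%:P * weighted s t f^`() by rewrite exprD; ring.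
  by rewrite eN exprD; ring.
pose w := (size g).-1; pose b := lead_coef g.
have b0 : b != 0 by rewrite lead_coef_eq0.
have sk0 : s%:R != 0 :> k by rewrite char0 -lt0n.
have invs : s%:R * (s%:R^-1)%:P = 1 :> {poly k}.
  by rewrite -polyC_natr -polyCM mulfV.
pose Q := (s%:R^-1)%:P * M`_N.
have eQ : P * b^`() = Q * b.
  by rewrite /Q -mulrA -(darboux_leading g0 N0 E) !mulrA [_%:P * _]mulrC invs mul1r.
have [q0 [G [G0 sub]]] := darboux_subleading g0 N0 M0 E.
rewrite -/w -/b in sub.
pose c := s%:R^-1 * N%:R : k.
have ec : c != 0 by rewrite mulf_neq0 ?invr_neq0 // char0 -lt0n.
have eqG : P ^+ 2 * (q0^`() * G - q0 * G^`())
   = c%:P * (w%:R * P - t%:R * ('X * Q)) * G ^+ 2.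
  apply: (mulIf b0).
  transitivity ((s%:R^-1)%:P * P * (s%:R * P * (G * q0^`() - G^`() * q0) * b)).
    by rewrite -[LHS]mul1r -[X in X * _ = _]invs; ring.
  have eb : t%:R * ('X * Q) * b = t%:R * 'X * (P * b^`()) by rewrite eQ; ring.
  rewrite sub /c polyCM polyC_natr.
  transitivity ((s%:R^-1)%:P * N%:R * G ^+ 2 * (w%:R * P * b - t%:R * ('X * Q) * b)).
    by rewrite eb; ring.
  by ring.
have copP : coprimep P P^`().
  have -> : P^`() = (c2 *+ s) *: 'X^(s.-1).
    rewrite /P derivD derivC add0r derivM derivC mul0r add0r derivXn mulrnAr.
    by rewrite -mulrnAl -polyCMn mul_polyC.
  rewrite coprimepZr; last by rewrite -mulr_natr mulf_neq0.
  apply: coprimep_expr; rewrite coprimepX /root /P !hornerE expr0n.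
  by rewrite (gtn_eqF s0) mulr0 addr0.
have [A eA] := quotient_antiderivative hk G0 copP eqG.
pose n := (size b).-1.
have topP : top_coef s P c2.
  split; last by rewrite coefD coefC coefCM coefXn eqxx (gtn_eqF s0) mulr1 add0r.
  rewrite (leq_trans (size_polyD _ _)) // geq_max (leq_trans (size_polyC_leq1 _)) //=.
  by rewrite mul_polyC (leq_trans (size_scale_leq _ _)) // size_polyXn.
have topb : top_coef n b (lead_coef b) by apply: top_coef_lead.
have sb : size b = n.+1 by rewrite /n prednK // size_poly_gt0.
have [|[sXQ _] cXQ] := @top_coef_factor _ s n ('X * Q) b (c2 * (lead_coef b *+ n)) b0 sb.
  have -> : 'X * Q * b = P * ('X * b^`()) by rewrite -mulrA -eQ; ring.
  by apply: top_coefM => //; apply: top_coef_deriv.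
have sQ : (size Q <= s)%N.
  have [->|Q0] := eqVneq Q 0; first by rewrite size_poly0.
  by move: sXQ; rewrite mulrC size_mulX.
have Qs : Q`_s.-1 = n%:R * c2.
  have lb0 : lead_coef b != 0 by rewrite lead_coef_eq0.
  apply: (mulIf lb0); move: cXQ; rewrite coefXM (gtn_eqF s0) => ->.
  by rewrite -mulr_natr; ring.
have := weight_degree_identity hk s2 c10 c20 ec sQ Qs eA.
have : (t * n <= w)%N by apply: size_coef_weighted.
have : (0 < w)%N by rewrite /w; move: sg; case: (size g) => [|[|]].
by nia.
Qed.

(** * Differential ideals *)

(** Each differentiation lowers the degree by exactly one in characteristic
    zero. *)
Lemma differential_ideal_one_of_const (k : fieldType) (hk : [pchar k] =i pred0)
    (Q : {poly {poly k}}) (I : {poly {poly k}} -> Prop) (c : {poly k}) :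
  is_differential_ideal (bideriv Q) I -> c != 0 -> I c%:P -> I 1.
Proof.
move=> [[_ _ IM] Id]; have [n] := ubnP (size c); elim: n c => // n IH c sc c0 Ic.
have [sc1|sc1] := leqP (size c) 1.
  have /size_poly1P[a a0 ea] : size c == 1%N by rewrite eqn_leq sc1 size_poly_gt0.
  have -> : 1 = a^-1%:P%:P * c%:P :> {poly {poly k}}.
    by rewrite ea -!polyCM mulVf.
  exact: IM.
apply: (IH c^`()).
- by rewrite -ltnS; apply: leq_trans sc; rewrite ltnS lt_size_deriv.
- by apply: contraTneq sc1 => /(deriv_eq0 hk); rewrite -leqNgt.
by rewrite -(biderivC Q); apply: Id.
Qed.

Lemma differential_ideal_one (k : fieldType) (hk : [pchar k] =i pred0)
    (s t u : nat) (c1 c2 : k) (I : {poly {poly k}} -> Prop) (f : {poly {poly k}}) :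
  (2 <= s)%N -> (1 <= t)%N -> c1 != 0 -> c2 != 0 ->
  is_differential_ideal (bideriv (planar_field s t u c1 c2)) I ->
  f != 0 -> I f -> I 1.
Proof.
set Q := planar_field _ _ _ _ _.
move=> s2 t1 c10 c20 dI; have [[_ ID IM] Id] := dI.
have [n] := ubnP (size f); elim: n f => // n IH f sf f0 If.
have [sf1|sf1] := leqP (size f) 1.
  move: f0 If; rewrite (size1_polyC sf1) polyC_eq0; exact: (differential_ideal_one_of_const hk dI).
set a := lead_coef f ^+ scalp (bideriv Q f) f.
have E : a *: bideriv Q f = bideriv Q f %/ f * f + bideriv Q f %% f.
  exact: Pdiv.Idomain.divp_eq.
have [r0|r0] := eqVneq (bideriv Q f %% f) 0.
  have a0 : a != 0 by rewrite expf_neq0 // lead_coef_eq0.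
  rewrite r0 addr0 in E.
  have [g [r [sg dg]]] := darboux_clear_denominator a0 f0 E.
  by move: sf1; rewrite -sg ltnNge (darboux_constant hk s2 t1 c10 c20 dg).
apply: (IH _ _ r0).
  by rewrite -ltnS; apply: leq_trans sf; rewrite ltnS Pdiv.Idomain.ltn_modpN0.
have -> : bideriv Q f %% f
  = a%:P * bideriv Q f + (- (bideriv Q f %/ f)) * f.
  by rewrite mul_polyC E mulNr addrC addKr.
by apply: ID; apply: IM => //; apply: Id.
Qed.

Section Transfer.

Variable k : fieldType.

(** Surjectivity of this morphism and its compatibility with the derivations
    suffice to transfer differential ideals: they are pulled back along it. *)
Definition to_mpoly : {poly {poly k}} -> {mpoly k[2]} :=
  horner_eval (vary k) \o map_poly (horner_alg (varx k)).
HB.instance Definition _ := GRing.RMorphism.on to_mpoly.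

Lemma to_mpolyCC (c : k) : to_mpoly c%:P%:P = c *: 1.
Proof. by rewrite /to_mpoly /= map_polyC /horner_eval hornerC /= horner_algC. Qed.

Lemma to_mpoly_x : to_mpoly 'X%:P = varx k.
Proof. by rewrite /to_mpoly /= map_polyC /horner_eval hornerC /= horner_algX. Qed.

Lemma to_mpoly_y : to_mpoly 'X = vary k.
Proof. by rewrite /to_mpoly /= map_polyX /horner_eval hornerX. Qed.

Lemma to_mpoly_surj (a : {mpoly k[2]}) : exists f, to_mpoly f = a.
Proof.
elim/mpolyind: a => [|c m p _ _ [f <-]]; first by exists 0; rewrite rmorph0.
have [h <-] : exists h, to_mpoly h = 'X_[m].
  rewrite mpolyXE_id; elim/big_rec: _ => [|i x _ [h <-]].
    by exists 1; rewrite rmorph1.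
  have [v <-] : exists v, to_mpoly v = 'X_i.
    have [->|->] : i = ord0 \/ i = ord_max.
      by case: i => -[|[|//]] lti; [left|right]; apply: val_inj.
    - by exists 'X%:P; rewrite to_mpoly_x.
    by exists 'X; rewrite to_mpoly_y.
  by exists (v ^+ m i * h); rewrite rmorphM rmorphXn.
by exists (c%:P%:P * h + f); rewrite rmorphD rmorphM /= to_mpolyCC -scalerAl mul1r.
Qed.

Lemma to_mpoly_derxy (Q f : {poly {poly k}}) :
  to_mpoly (bideriv Q f) = derxy 1 (to_mpoly Q) (to_mpoly f).
Proof.
have [[dD dM] dZ] := derxy_kderivation 1 (to_mpoly Q).
move: f; apply: (@derivation_along_unique _ _ to_mpoly) => [a b|a b|a b|a b|c||].
- by rewrite biderivD rmorphD.
- by rewrite rmorphD dD.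
- by rewrite biderivM rmorphD !rmorphM.
- by rewrite rmorphM dM.
- rewrite biderivC derivC polyC0 rmorph0 to_mpolyCC dZ.
  have := dM 1 1; rewrite !mul1r => /eqP.
  by rewrite -subr_eq0 opprD addNKr oppr_eq0 => /eqP ->; rewrite scaler0.
- by rewrite biderivC derivX !rmorph1 to_mpoly_x derxy_varx.
by rewrite /bideriv deriv_coefsX derivX add0r mulr1 to_mpoly_y derxy_vary.
Qed.

End Transfer.

Theorem theorem4p4 (k : fieldType) (hk : [pchar k] =i pred0)
  (s t u : nat) (hs : (2 <= s)%N) (ht : (1 <= t)%N)
  (c1 c2 : k) (hc1 : c1 != 0) (hc2 : c2 != 0) :
  is_simple_derivation
    (derxy 1 (varx k ^+ u * (c1 *: varx k ^+ t + c2 *: vary k ^+ s))).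
Proof.
set R := varx k ^+ u * _.
have [dR _] := derxy_kderivation 1 R; split=> // I [[I0 ID IM] Id].
have eR : R = to_mpoly (planar_field s t u c1 c2).
  rewrite /planar_field rmorphM rmorphD !rmorphM !rmorphXn /=.
  by rewrite !to_mpolyCC to_mpoly_x to_mpoly_y -!scalerAl !mul1r.
pose J f := I (to_mpoly f).
have dJ : is_differential_ideal (bideriv (planar_field s t u c1 c2)) J.
  split; last by move=> f; rewrite /J to_mpoly_derxy -eR; apply: Id.
  split=> [|a b|a b]; rewrite /J ?rmorph0 ?rmorphD ?rmorphM //; first exact: ID.
  exact: IM.
have [[f [If f0]]|noJ] := classic (exists f, J f /\ f != 0).
  right=> a; rewrite -[a]mulr1; apply: IM.
  by rewrite -(rmorph1 (@to_mpoly k)); apply: (differential_ideal_one hk _ _ _ _ dJ f0 If).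
left=> a; split=> [Ia|->//].
have [f ef] := to_mpoly_surj a; rewrite -ef.
have [->|f0] := eqVneq f 0; first by rewrite rmorph0.
by case: noJ; exists f; rewrite /J ef.
Qed.
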